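(* Consider the $p$-tensor Curie-Weiss model for $p=2$. For every $\beta>\beta_0>\beta^*(2)$ and $\delta\in(0,1)$, $$c_{\hat{\beta}_{\mathrm{MPL}}}(\beta_0,\beta,2) = c_{\hat{\beta}_{\mathrm{ML}}}(\beta_0,\beta,2)\quad\text{and}\quad N_{\hat{\beta}_{\mathrm{MPL}}}^*(\beta_0,\beta,\delta,2) = N_{\hat{\beta}_{\mathrm{ML}}}^*(\beta_0,\beta,\delta,2).$$ Consequently, the Bahadur asymptotic relative efficiency satisfies $\mathrm{eff}(\hat{\beta}_{\mathrm{ML}},\hat{\beta}_{\mathrm{MPL}};\beta_0,\beta)=1$.
   Context: **Model.** For an integer $p\ge2$ and $n\ge 1$, the $p$-tensor Curie-Weiss model with parameter $\beta$ is the probability mass function on $\{-1,1\}^n$ $$\mathbb{P}_{\beta,p}(x)=\frac{\exp\{\beta n^{1-p}\sum_{1\le i_1,\dots,i_p\le n}x_{i_1}\cdots x_{i_p}\}}{2^nZ_n(\beta,p)},$$ with $Z_n(\beta,p)$ the normalizing constant. $X=(X_1,\dots,X_n)$ denotes a sample from it and $\overline{X}_n=\frac1n\sum_{i=1}^nX_i$. **Threshold.** For $x\in[-1,1]$ (with $0\log0=0$), $H_{\beta,p}(x)=\beta x^p-\tfrac12\{(1+x)\log(1+x)+(1-x)\log(1-x)\}$, and $\beta^*(p)=\sup\{\beta\ge0:\sup_{x\in[-1,1]}H_{\beta,p}(x)=0\}$ (so $\beta^*(2)=1/2$). **Estimators.** $\hat{\beta}_{\mathrm{ML}}$ is the maximum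 likelihood estimator of $\beta$, i.e. the maximizer of $\beta\mapsto\mathbb{P}_{\beta,p}(X)$ (equal to $\pm\infty$ if the supremum is only approached at $\pm\infty$). The maximum pseudolikelihood estimator is given explicitly by $\hat{\beta}_{\mathrm{MPL}}=p^{-1}\overline{X}_n^{1-p}\tanh^{-1}(\overline{X}_n)$ if $\overline{X}_n\ne0$ and $0$ if $\overline{X}_n=0$ (extended-real valued when $\overline X_n=\pm1$). **Bahadur slope.** Consider testing $H_0:\beta=\beta_0$ versus $H_1:\beta>\beta_0$ with $\beta_0>\beta^*(p)$ using $T_n=\sqrt n(\hat\beta-\beta_0)$, where $\hat\beta$ is $\hat{\beta}_{\mathrm{ML}}$ or $\hat{\beta}_{\mathrm{MPL}}$, large values being significant. Let $F_{T_n,\beta_0}$ be the cumulative distribution function of $T_n$ under $\mathbb{P}_{\beta_0,p}$ and $L_n=1-F_{T_n,\beta_0}(T_n)$. The (weak) Bahadur slope of $\hat\beta$ at the alternative $\beta$ is the constant $c_{\hat\beta}(\beta_0,\beta,p)$ such that $\frac1n\log L_n\to-\frac12c_{\hat\beta}(\beta_0,\beta,p)$ in probability as $n\to\infty$ when $X\sim\mathbb{P}_{\beta,p}$. The asymptotic optimal sample size is $N^*_{\hat\beta}(\beta_0,\beta,\delta,p)=-2\log(\delta)/c_{\hat\beta}(\beta_0,\beta,p)$, and $\mathrm{eff}(\hat\beta_1,\hat\beta_2;\beta_0,\beta)=c_{\hat\beta_1}(\beta_0,\beta,p)/c_{\hat\beta_2}(\beta_0,\beta,p)$. *)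

(* Defs.v *)
From mathcomp Require Import all_boot all_order all_algebra.
From mathcomp Require Import all_classical all_reals all_analysis.
Set Implicit Arguments.
Unset Strict Implicit.
Unset Printing Implicit Defensive.
Import Order.TTheory GRing.Theory Num.Theory.
Import numFieldNormedType.Exports.
Local Open Scope classical_set_scope.
Local Open Scope ring_scope.

(* The configuration space {-1, 1}^n: [true] encodes the spin 1 and [false]
   the spin -1. *)
Definition config (n : nat) := {ffun 'I_n -> bool}.

Section CurieWeiss.
Context {R : realType}.

Definition spin n (x : config n) (i : 'I_n) : R := if x i then 1 else -1.

(* n^(1-p) times the sum over all index tuples (i_1, ..., i_p) in [n]^p,
   repetitions allowed, of x_(i_1) ... x_(i_p). *)
Definition hamiltonian p n (x : config n) : R :=
  n%:R ^ (1 - p%:Z) *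
  \sum_(i : {ffun 'I_p -> 'I_n}) \prod_(j < p) spin x (i j).

Definition partition_function p n (b : R) : R :=
  2 ^- n * \sum_(x : config n) expR (b * hamiltonian p x).

Definition pmf p n (b : R) (x : config n) : R :=
  expR (b * hamiltonian p x) / (2 ^+ n * partition_function p n b).

Definition prob p n (b : R) (A : pred (config n)) : R :=
  \sum_(x : config n | A x) pmf p b x.

Definition xbar n (x : config n) : R := n%:R^-1 * \sum_(i < n) spin x i.

(* Since [ln 0 = 0], the convention 0 log 0 = 0 holds at the endpoints. *)
Definition H_fun p (b x : R) : R :=
  b * x ^+ p - 2^-1 * ((1 + x) * ln (1 + x) + (1 - x) * ln (1 - x)).

(* Both suprema are over nonempty sets that are bounded above for p > 0, so the
   real-valued [sup] is the genuine supremum. *)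
Definition beta_star p : R :=
  sup [set b | 0 <= b /\ sup [set H_fun p b x | x in `[(-1), 1] ] = 0].

Definition is_likelihood_max p n (x : config n) (b : R) : Prop :=
  forall b', pmf p b' x <= pmf p b x.

Definition sup_likelihood p n (x : config n) : R :=
  sup (range (fun b => pmf p b x)).

Definition is_ML p n (x : config n) (b : \bar R) : Prop :=
  match b with
  | r%:E => is_likelihood_max p x r
  | +oo%E => ~ (exists r, is_likelihood_max p x r) /\
             pmf p r x @[r --> +oo] --> sup_likelihood p x
  | -oo%E => ~ (exists r, is_likelihood_max p x r) /\
             pmf p r x @[r --> -oo] --> sup_likelihood p x
  end.

(* An estimator is a map from configurations, for all sample sizes, to the
   extended reals. *)
Definition estimator := forall n, config n -> \bar R.

(* When the likelihood is constant in the parameter (for p = 2, only if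
   n <= 1), every real is a maximizer and an arbitrary one is selected. *)
Definition beta_ML p : estimator := fun n x => get [set b | is_ML p x b].

Definition atanhe (t : R) : \bar R :=
  if t == 1 then +oo%E else if t == -1 then -oo%E
  else (2^-1 * ln ((1 + t) / (1 - t)))%:E.

Definition beta_MPL p : estimator := fun n x =>
  if xbar x == 0 then 0%E
  else ((p%:R^-1 * xbar x ^ (1 - p%:Z))%:E * atanhe (xbar x))%E.

Definition test_stat (est : estimator) (b0 : R) n (x : config n) : \bar R :=
  ((Num.sqrt n%:R)%:E * (est n x - b0%:E))%E.

Definition test_cdf (est : estimator) p (b0 : R) n (t : \bar R) : R :=
  prob p b0 (fun x : config n => (test_stat est b0 x <= t)%E).

Definition Lstat (est : estimator) p (b0 : R) n (x : config n) : R :=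
  1 - test_cdf est p b0 n (test_stat est b0 x).

Definition cvg_in_prob p (b : R) (Y : estimator) (l : R) : Prop :=
  forall e : R, 0 < e ->
    prob p b (fun x : config n => (e%:E < `|Y n x - l%:E|)%E) @[n --> \oo]
      --> (0 : R).

(* [Lstat] vanishes where the statistic is maximal, so its logarithm is the
   extended one, with [lne 0 = -oo]. *)
Definition is_bahadur_slope (est : estimator) p (b0 b c : R) : Prop :=
  cvg_in_prob p b
    (fun n x => ((n%:R^-1)%:E * lne (Lstat est p b0 x)%:E)%E) (- (2^-1 * c)).

(* Meaningful when a slope exists; it is then unique, limits in probability
   being unique. *)
Definition bahadur_slope (est : estimator) p (b0 b : R) : R :=
  get [set c | is_bahadur_slope est p b0 b c].

Definition opt_sample_size (est : estimator) p (b0 b delta : R) : R :=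
  - 2 * ln delta / bahadur_slope est p b0 b.

Definition bahadur_eff (est1 est2 : estimator) p (b0 b : R) : R :=
  bahadur_slope est1 p b0 b / bahadur_slope est2 p b0 b.

End CurieWeiss.

(* Main.v *)
(* On an n-point sample with n >= 2, the sufficient statistic of the model with
   p = 2 is [|xbar|], and both estimators are strictly increasing functions of it:
   [beta_MPL] because artanh(t) / t increases, [beta_ML] because the likelihood
   ratio of two samples is monotone in the parameter. Hence both tests have the
   same p-value P_(b0)(|xbar(Y)| > |xbar(X)|). Counting configurations by their
   number of up spins gives P_b(xbar in A) = exp(n (sup_A H_b - sup H_b + o(1))).
   Above the threshold, |xbar| concentrates under P_b at the positive root m(b) of
   artanh(m) = 2 b m, which is increasing in b and maximizes H_b, so the common
   slope is 2 (H_(b0)(m(b0)) - H_(b0)(m(b))) > 0. *)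
Require Import Defs.
From mathcomp Require Import all_boot all_order all_algebra.
From mathcomp Require Import all_classical all_reals all_analysis.
From mathcomp Require Import ring lra zify.
Import Order.TTheory GRing.Theory Num.Theory.
Import numFieldNormedType.Exports.
Local Open Scope classical_set_scope.
Local Open Scope ring_scope.
Set Implicit Arguments.
Unset Strict Implicit.
Unset Printing Implicit Defensive.

(** * Artanh, the roots of [artanh m = 2 * b * m], and the shape of the rate function *)

Section RateFunction.
Context {R : realType}.
Implicit Types (x y m b : R) (f df : R -> R).

(** A difference of logarithms is odd without side conditions. The derivative of [H_fun 2 b] at [m]
    is [2 * b * m - artanh m], so critical points solve [artanh m = 2 * b * m]. *)
Definition artanh (m : R) : R := 2^-1 * (ln (1 + m) - ln (1 - m)).

Lemma is_derive_lt f df x y : x < y ->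
  (forall z, x <= z <= y -> is_derive z 1 f (df z)) ->
  (forall z, x < z < y -> 0 < df z) -> f x < f y.
Proof.
move=> xy fE df0.
have [z|z|z] := @MVT R f df x y xy.
- by rewrite in_itv/= => /andP[xz zy]; apply: fE; rewrite !ltW.
- apply: derivable_within_continuous z => z /[!in_itv]/= zxy.
  by have := fE z zxy => ?; apply: ex_derive.
rewrite in_itv/= => zxy /eqP; rewrite subr_eq => /eqP ->.
by rewrite ltrDr mulr_gt0 ?df0 ?subr_gt0.
Qed.

Lemma is_derive_le f df x y : x <= y ->
  (forall z, x <= z <= y -> is_derive z 1 f (df z)) ->
  (forall z, x < z < y -> 0 <= df z) -> f x <= f y.
Proof.
rewrite le_eqVlt => /predU1P[->//|xy] fE df0.
have [z|z|z] := @MVT R f df x y xy.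
- by rewrite in_itv/= => /andP[xz zy]; apply: fE; rewrite !ltW.
- apply: derivable_within_continuous z => z /[!in_itv]/= zxy.
  by have := fE z zxy => ?; apply: ex_derive.
rewrite in_itv/= => zxy /eqP; rewrite subr_eq => /eqP ->.
by rewrite lerDr mulr_ge0 ?df0 ?subr_ge0 ?ltW.
Qed.

Lemma is_derive_ln1D m : -1 < m -> is_derive m 1 (fun x => ln (1 + x)) (1 + m)^-1.
Proof.
move=> m1; have dln : is_derive (1 + m) 1 (@ln R) (1 + m)^-1.
  by apply: is_derive1_ln; lra.
have dD : is_derive m 1 (fun x : R => 1 + x) 1.
  by apply: is_derive_eq; rewrite add0r mulr1.
by have := @is_derive1_comp _ _ (fun x : R => 1 + x) _ _ _ dln dD; rewrite mulr1.
Qed.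

Lemma is_derive_ln1B m : m < 1 -> is_derive m 1 (fun x => ln (1 - x)) (- (1 - m)^-1).
Proof.
move=> m1; have dln : is_derive (1 - m) 1 (@ln R) (1 - m)^-1.
  by apply: is_derive1_ln; lra.
have dB : is_derive m 1 (fun x : R => 1 - x) (-1).
  by apply: is_derive_eq; rewrite add0r; ring.
by have := @is_derive1_comp _ _ (fun x : R => 1 - x) _ _ _ dln dB; rewrite mulrN1.
Qed.

Lemma is_derive_artanh m : -1 < m < 1 -> is_derive m 1 artanh (1 - m ^+ 2)^-1.
Proof.
move=> /andP[m1 m2].
have := is_derive_ln1D m1; have := is_derive_ln1B m2 => ? ?.
apply: is_derive_eq.
have ? : 1 - m != 0 by rewrite gt_eqF//; lra.
have ? : 1 + m != 0 by rewrite gt_eqF//; lra.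
have ? : 1 - m ^+ 2 != 0 by rewrite (_ : _ - _ = (1 - m) * (1 + m)) ?mulf_neq0//; ring.
by rewrite /GRing.scale/=; field; do ?[apply/andP; split].
Qed.

Lemma is_derive_H_fun b m : -1 < m < 1 ->
  is_derive m 1 (H_fun 2 b) (2 * b * m - artanh m).
Proof.
move=> /andP[m1 m2].
have := is_derive_ln1D m1; have := is_derive_ln1B m2 => ? ?.
apply: is_derive_eq.
have ? : 1 - m != 0 by rewrite gt_eqF//; lra.
have ? : 1 + m != 0 by rewrite gt_eqF//; lra.
rewrite /artanh /GRing.scale/=; field; do ?[apply/andP; split=> //].
Qed.


Lemma artanh0 : artanh 0 = 0.
Proof. by rewrite /artanh addr0 subr0 subrr mulr0. Qed.

Lemma artanhN m : artanh (- m) = - artanh m.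
Proof. by rewrite /artanh opprK -mulrN opprB. Qed.

Lemma sub1_sqr_gt0 m : -1 < m < 1 -> 0 < 1 - m ^+ 2.
Proof.
move=> /andP[m1 m2]; rewrite (_ : _ - _ = (1 - m) * (1 + m)); last by ring.
by apply: mulr_gt0; lra.
Qed.

Lemma artanh_ge_id m : 0 <= m < 1 -> m <= artanh m.
Proof.
move=> /andP[m0 m1]; rewrite -subr_ge0.
have -> : 0 = artanh 0 - 0 by rewrite artanh0 subrr.
apply: (@is_derive_le (fun z => artanh z - z) (fun z => (1 - z ^+ 2)^-1 - 1) _ _ m0).
  move=> z zm; have : -1 < z < 1 by lra.
  by move=> /is_derive_artanh ?; apply: is_derive_eq.
move=> z zm; have z1 : -1 < z < 1 by lra.
rewrite subr_ge0 invf_ge1 ?sub1_sqr_gt0// lerBlDr lerDl.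
by rewrite sqr_ge0.
Qed.

(** The difference of the two sides, as a function of [m], vanishes at 0 and has derivative c (1/(1
    - z^2) - 1/(1 - c^2 z^2)), positive for 0 < z < 1. *)
Lemma artanhM_lt c m : 0 < c < 1 -> 0 < m < 1 -> artanh (c * m) < c * artanh m.
Proof.
move=> c01 m01; rewrite -subr_gt0.
have E : 0 = c * artanh 0 - artanh (c * 0) by rewrite mulr0 artanh0; ring.
rewrite [ltLHS]E.
apply: (@is_derive_lt (fun z => c * artanh z - artanh (c * z))
    (fun z => c * (1 - z ^+ 2)^-1 - (1 - (c * z) ^+ 2)^-1 * c)) => [|z zm|z zm].
- by lra.
- have z1 : -1 < z < 1 by lra.
  have cz1 : -1 < c * z < 1 by nra.
  have D1 := is_derive_artanh z1.
  have D2 := is_derive_artanh cz1.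
  have D3 : is_derive z 1 (fun z : R => c * z) c.
    by apply: is_derive_eq; rewrite /GRing.scale/=; ring.
  have D4 := @is_derive1_comp _ _ (fun z : R => c * z) _ _ _ D2 D3.
  have D5 : is_derive z 1 (fun z : R => artanh (c * z)) ((1 - (c * z) ^+ 2)^-1 * c) := D4.
  have D6 := @is_deriveZ _ _ _ _ c _ _ _ D1.
  exact: (is_deriveB D6 D5).
- have z1 : -1 < z < 1 by lra.
  have cz1 : -1 < c * z < 1 by nra.
  rewrite [_^-1 * c]mulrC -mulrBr mulr_gt0//; first by case/andP: c01.
  rewrite subr_gt0 ltf_pV2 ?posrE ?sub1_sqr_gt0// ltrD2l ltrN2.
  rewrite exprMn gtr_pMl ?exprn_gt0; [|by lra|by lra].
  by rewrite expr2; nra.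
Qed.

(** Scaling inequality with factor [x / y]. It decides the sign of [2 * b * x - artanh x] on either
    side of a root, and it makes [beta_MPL] increase with the absolute magnetization. *)
Lemma artanh_div_lt x y : 0 < x -> x < y -> y < 1 -> artanh x / x < artanh y / y.
Proof.
move=> x0 xy y1; have y0 := lt_trans x0 xy.
have := @artanhM_lt (x / y) y; rewrite divfK ?gt_eqF// => /(_ _ _)/=.
rewrite divr_gt0//= ltr_pdivrMr// mul1r y0 xy/= => /(_ isT y1).
by rewrite ltr_pdivrMr// mulrAC -mulrA mulrC.
Qed.

Lemma exists_artanh_eq x : 0 < x -> exists2 m, 0 < m < 1 & artanh m = x.
Proof.
move=> x0; have e1 : 1 < expR (2 * x) by rewrite expR_gt1; lra.
have d0 : 0 < expR (2 * x) + 1 by lra.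
(* The witness is tanh x. *)
exists ((expR (2 * x) - 1) / (expR (2 * x) + 1)).
  apply/andP; split; first by rewrite divr_gt0; lra.
  by rewrite ltr_pdivrMr// mul1r; lra.
rewrite /artanh -ln_div ?posrE.
- rewrite (_ : _ / _ = expR (2 * x)) ?expRK; first by field.
  by field; rewrite !gt_eqF//; lra.
- rewrite (_ : 1 + _ = 2 * expR (2 * x) / (expR (2 * x) + 1)).
    by rewrite divr_gt0//; lra.
  by field; rewrite gt_eqF.
- rewrite (_ : 1 - _ = 2 / (expR (2 * x) + 1)); first by rewrite divr_gt0.
  by field; rewrite gt_eqF.
Qed.

Lemma artanh_le m : 0 <= m < 1 -> artanh m <= m / (1 - m).
Proof.
move=> /andP[m0 m1]; rewrite /artanh -ln_div ?posrE; [|lra..].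
have -> : (1 + m) / (1 - m) = 1 + 2 * m / (1 - m) by field; rewrite gt_eqF//; lra.
have q0 : 0 <= m / (1 - m) by rewrite divr_ge0//; lra.
have := @le_ln1Dx R (2 * m / (1 - m)); rewrite -mulrA; lra.
Qed.

Lemma exists_artanh_root b : 2^-1 < b -> exists2 m, 0 < m < 1 & artanh m = 2 * b * m.
Proof.
move=> b2; have b0 : 0 < b by lra.
have [y y01 yE] := @exists_artanh_eq (2 * b) ltac:(lra).
(* Here [1 - x] is the midpoint of 1/(2b) and 1, so artanh x <= x/(1 - x) < 2bx. At [y] the sign is
   reversed, as artanh y = 2b > 2by. *)
set x := (1 - (2 * b)^-1) / 2.
have i0 : 0 < (2 * b)^-1 by rewrite invr_gt0; lra.
have i1 : (2 * b)^-1 < 1 by rewrite invf_lt1; lra.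
have x01 : 0 < x < 1 by rewrite /x; lra.
have xE : artanh x < 2 * b * x.
  apply: (le_lt_trans (artanh_le _)); first by lra.
  rewrite mulrC ltr_pM2r; last by lra.
  rewrite -[ltRHS]invrK ltf_pV2 ?posrE//; last by lra.
  by rewrite /x; lra.
(* Otherwise monotonicity of artanh z / z would give 2b/y <= artanh x / x < 2b, against y < 1. *)
have xy : x < y.
  case: (ltP x y) => // yx; exfalso.
  have : artanh y / y <= artanh x / x.
    by move: yx; rewrite le_eqVlt => /predU1P[->//|yx]; apply/ltW/artanh_div_lt; lra.
  rewrite ler_pdivlMr; last by lra.
  rewrite yE; have y1 : 1 < y^-1 by rewrite invf_gt1; lra.
  have : 0 < (2 * b * x) * (y^-1 - 1) by rewrite !mulr_gt0//; lra.
  lra.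
have [||m] := @IVT R (fun z => artanh z - 2 * b * z) x y 0 (ltW xy).
- apply: derivable_within_continuous => z; rewrite in_itv/= => zxy.
  have /is_derive_artanh ? : -1 < z < 1 by lra.
  by apply: ex_derive.
- rewrite ge_min le_max; apply/andP; split; apply/orP; [left|right].
    by lra.
  by rewrite yE; nra.
rewrite in_itv/= => mxy /eqP; rewrite subr_eq0 => /eqP mE.
by exists m => //; lra.
Qed.

Lemma artanh_lt_root b m x : 0 < m < 1 -> artanh m = 2 * b * m -> 0 < x < m ->
  artanh x < 2 * b * x.
Proof.
move=> m01 mE xm; rewrite -ltr_pdivrMr; last by lra.
have -> : 2 * b = artanh m / m by rewrite mE mulfK// gt_eqF//; lra.
by apply: artanh_div_lt; lra.
Qed.

Lemma artanh_gt_root b m x : 0 < m < 1 -> artanh m = 2 * b * m -> m < x < 1 ->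
  2 * b * x < artanh x.
Proof.
move=> m01 mE xm; rewrite -ltr_pdivlMr; last by lra.
have -> : 2 * b = artanh m / m by rewrite mE mulfK// gt_eqF//; lra.
by apply: artanh_div_lt; lra.
Qed.

Lemma artanh_root_lt b b' m m' : 0 < m < 1 -> 0 < m' < 1 ->
  artanh m = 2 * b * m -> artanh m' = 2 * b' * m' -> b < b' -> m < m'.
Proof.
move=> m01 m'01 mE m'E bb'; rewrite ltNge; apply/negP => m'm.
have : 2 * b * m' < artanh m' by rewrite m'E ltr_pM2r; lra.
apply/negP; rewrite -leNgt; move: m'm; rewrite le_eqVlt => /predU1P[->|m'm].
  by rewrite mE.
by apply/ltW/(artanh_lt_root m01 mE); lra.
Qed.

Lemma H_funN b x : H_fun 2 b (- x) = H_fun 2 b x.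
Proof. by rewrite /H_fun sqrrN opprK; ring. Qed.

Lemma H_fun_norm b x : H_fun 2 b `|x| = H_fun 2 b x.
Proof. by case: (ger0P x) => // _; rewrite H_funN. Qed.

Lemma H_fun0 b : H_fun 2 b 0 = 0.
Proof. by rewrite /H_fun subr0 addr0 ln1 expr0n/=; ring. Qed.

Lemma H_fun1 b : H_fun 2 b 1 = b - ln 2.
Proof. by rewrite /H_fun subrr mul0r expr1n -[1 + 1]/(2%:R); field. Qed.

Lemma H_fun_incr b m x y : 0 < m < 1 -> artanh m = 2 * b * m ->
  0 <= x -> x < y -> y <= m -> H_fun 2 b x < H_fun 2 b y.
Proof.
move=> m01 mE x0 xy ym.
apply: (@is_derive_lt (H_fun 2 b) (fun z => 2 * b * z - artanh z) _ _ xy) => z zxy.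
  by apply: is_derive_H_fun; lra.
rewrite subr_gt0; apply: (artanh_lt_root m01 mE); lra.
Qed.

(* [H_fun] is not differentiable at [1]; the entropy part lies above its tangent
   at [x], which bounds the value at [1]. *)
Lemma H_fun1_le b x : 0 < x < 1 -> 2 * b <= artanh x -> 0 <= b ->
  H_fun 2 b 1 <= H_fun 2 b x.
Proof.
move=> x01 bx b0; rewrite H_fun1 /H_fun.
have uw : ln (1 + x) <= ln 2 by rewrite ler_ln ?posrE; lra.
have : (1 - x) * (2 * b) <= (1 - x) * artanh x by rewrite ler_pM2l; lra.
have : 0 <= b * (1 - x) ^+ 2 by rewrite mulr_ge0// sqr_ge0.
move: uw; rewrite /artanh.
set u := ln (1 + x); set v := ln (1 - x); set w := ln 2.
rewrite !expr2; lra.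
Qed.

(** The condition on (a, 1) is nonstrict in order to serve both [a = 0] at b = 1/2 and [a] equal to
    the positive root. The derivative settles [y < 1]; the endpoint 1 is reached through
    [H_fun1_le]. *)
Lemma H_fun_decr b a x y : 0 <= a -> 0 <= b ->
  (forall z, a < z < 1 -> 2 * b * z <= artanh z) ->
  a <= x -> x <= y -> y <= 1 -> H_fun 2 b y <= H_fun 2 b x.
Proof.
move=> a0 b0 bE.
have H1 u v : a <= u -> u <= v -> v < 1 -> H_fun 2 b v <= H_fun 2 b u.
  move=> au uv v1; rewrite -lerN2.
  apply: (@is_derive_le (fun z => - H_fun 2 b z) (fun z => - (2 * b * z - artanh z)) _ _ uv).
    by move=> z zuv; apply/is_deriveN/is_derive_H_fun; lra.
  by move=> z zuv; rewrite oppr_ge0 subr_le0 bE//; lra.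
move=> ax xy; rewrite le_eqVlt => /predU1P[y1|]; last exact: H1.
rewrite {}y1 in xy *; move: xy; rewrite le_eqVlt => /predU1P[->//|x1].
(* The intermediate point [z] lies at or beyond [x], strictly between [m] and 1, so artanh z > 2b +
   1 and the tangent bound applies at [z]. *)
have [m m01 mE] := @exists_artanh_eq (2 * b + 1) ltac:(lra).
set z := Num.max x ((1 + m) / 2).
have [xz mz] : x <= z /\ (1 + m) / 2 <= z by rewrite /z !le_max !lexx orbT.
have z1 : z < 1 by rewrite /z gt_max x1/=; lra.
apply: le_trans (H1 x z ax xz z1); apply: H_fun1_le => //; first by lra.
have : artanh m / m < artanh z / z by apply: artanh_div_lt; lra.
rewrite ltr_pdivrMr; last by lra.
have q0 : z * (artanh z / z) = artanh z by rewrite mulrC divfK// gt_eqF//; lra.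
rewrite mE; set t := _ / z in q0 *; rewrite -q0 => tm.
nra.
Qed.

(** Strictness comes from the half of [x, y] up to the midpoint, where [H_fun] is differentiable
    even if [y = 1]. *)
Lemma H_fun_decr_lt b m x y : 0 < m < 1 -> artanh m = 2 * b * m -> 0 <= b ->
  m <= x -> x < y -> y <= 1 -> H_fun 2 b y < H_fun 2 b x.
Proof.
move=> m01 mE b0 mx xy y1; set z := (x + y) / 2.
apply: (@le_lt_trans _ _ (H_fun 2 b z)).
  apply: (@H_fun_decr b m) => //; rewrite /z; [lra| |lra..].
  by move=> t mt; apply/ltW/(artanh_gt_root m01 mE).
rewrite -ltrN2.
apply: (@is_derive_lt (fun z => - H_fun 2 b z) (fun z => - (2 * b * z - artanh z))).
- by rewrite /z; lra.
- by move=> t; rewrite /z => tE; apply/is_deriveN/is_derive_H_fun; lra.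
- move=> t; rewrite /z => tE; rewrite oppr_gt0 subr_lt0.
  by apply: (artanh_gt_root m01 mE); lra.
Qed.

Lemma H_fun_le_half x : -1 <= x <= 1 -> H_fun 2 2^-1 x <= 0.
Proof.
move=> x1; rewrite -H_fun_norm -(H_fun0 2^-1).
apply: (@H_fun_decr 2^-1 0); rewrite ?normr_ge0//.
  by move=> z z01; rewrite mulfV ?pnatr_eq0// mul1r artanh_ge_id//; lra.
by rewrite ler_norml.
Qed.

(** The value 1/2 belongs to the defining set of [beta_star], by [H_fun_le_half]. Hence every b0
    above the threshold exceeds 1/2 and [exists_artanh_root] applies. *)
Lemma beta_star_ge_half : 2^-1 <= beta_star 2 :> R.
Proof.
have H1 x : x ^+ 2 <= 1 <-> -1 <= x <= 1.
  by rewrite -ler_norml -{1}(expr1n _ 2) -real_normK ?num_real// ler_pXn2r ?nnegrE.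
have ubH b : has_ubound [set H_fun 2 b x | x in `[(-1 : R), 1]%classic].
  exists `|b - 2^-1| => y [x]/=; rewrite in_itv/= => x1 <-.
  have -> : H_fun 2 b x = (b - 2^-1) * x ^+ 2 + H_fun 2 2^-1 x by rewrite /H_fun; ring.
  have := H_fun_le_half x1; move/H1: x1 => x1.
  have : (b - 2^-1) * x ^+ 2 <= `|b - 2^-1|.
    apply: (le_trans (ler_norm _)); rewrite normrM [`|x ^+ 2|]ger0_norm ?sqr_ge0//.
    by rewrite ler_piMr.
  lra.
have H0 b : [set H_fun 2 b x | x in `[(-1 : R), 1]%classic] 0.
  by exists 0; rewrite ?H_fun0//= in_itv/=; lra.
apply: ub_le_sup.
  (* The defining set is bounded by ln 2, because the value of [H_fun 2 b] at 1 is b - ln 2. *)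
  exists (ln 2) => b /= [b0 bE]; rewrite leNgt; apply/negP => lb.
  have : H_fun 2 b 1 <= 0.
    by rewrite -bE; apply: ub_le_sup => //; exists 1 => //=; rewrite in_itv/=; lra.
  by rewrite H_fun1; lra.
split; first by lra.
apply/eqP; rewrite eq_le; apply/andP; split; last exact: ub_le_sup.
apply: ge_sup; first by exists 0.
by move=> y [x]/=; rewrite in_itv/= => x1 <-; apply: H_fun_le_half.
Qed.

End RateFunction.

(** * The mode of a binomial law and a polynomial lower bound on its mass *)

Section BinomialWeights.
Local Open Scope nat_scope.

(** For k + l > 0 this is (k+l)^(k+l) times the probability that a binomial variable with k + l
    trials and success probability k/(k+l) equals j. *)
Definition bin_weight k l j := 'C(k + l, j) * (k ^ j * l ^ (k + l - j)).

(** With [bin_weightE], this exposes a common factor of consecutive weights, so that comparing them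
    amounts to comparing (k + l - j) k with (j + 1) l. *)
Lemma bin_weightS k l j : j < k + l ->
  (bin_weight k l j.+1 * j.+1 = 'C(k + l, j) * (k ^ j * l ^ (k + l - j.+1)) * ((k + l - j) * k)).
Proof.
move=> jkl; rewrite /bin_weight mulnAC ['C(_, _) * _]mulnC mul_bin_left expnS; lia.
Qed.

Lemma bin_weightE k l j : j < k + l ->
  (bin_weight k l j * j.+1 = 'C(k + l, j) * (k ^ j * l ^ (k + l - j.+1)) * (j.+1 * l)).
Proof. by move=> jkl; rewrite /bin_weight -(subnSK jkl) expnS; lia. Qed.

Lemma bin_weight_incr k l j : j < k -> bin_weight k l j <= bin_weight k l j.+1.
Proof.
move=> jk; have jkl : j < k + l by lia.
rewrite -(@leq_pmul2r j.+1)// bin_weightS// bin_weightE// leq_mul2l; apply/orP; right.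
by rewrite [X in _ <= X]mulnC leq_mul//; lia.
Qed.

Lemma bin_weight_decr k l j : k <= j -> j < k + l -> bin_weight k l j.+1 <= bin_weight k l j.
Proof.
move=> jk jkl.
rewrite -(@leq_pmul2r j.+1)// bin_weightS// bin_weightE// leq_mul2l; apply/orP; right.
by rewrite mulnC leq_mul//; lia.
Qed.

Lemma bin_weight_mode k l j : j <= k + l -> bin_weight k l j <= bin_weight k l k.
Proof.
move=> jkl; have [jk|kj] := leqP j k.
  rewrite -(subKn jk); elim: (k - j) (leq_subr j k) => [|d IH] dk; first by rewrite subn0.
  apply: leq_trans (IH (ltnW dk)).
  by rewrite -(subnSK dk); apply: bin_weight_incr; lia.
have -> : j = k + (j - k) by lia.
elim: (j - k) (leq_sub2r k jkl) => [|d IH] dk; first by rewrite addn0.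
apply: leq_trans (IH (ltnW dk)).
by rewrite addnS; apply: bin_weight_decr; lia.
Qed.

Lemma sum_bin_weight k l : \sum_(j < (k + l).+1) bin_weight k l j = (k + l) ^ (k + l).
Proof.
transitivity ((l + k) ^ (k + l)); last by rewrite [l + k]addnC.
rewrite expnDn; apply: eq_bigr => j _.
by rewrite /bin_weight [l ^ _ * _]mulnC.
Qed.

Lemma bin_weight_le k l : bin_weight k l k <= (k + l) ^ (k + l).
Proof.
have kl : k < (k + l).+1 by lia.
by rewrite -sum_bin_weight (bigD1 (Ordinal kl))//= leq_addr.
Qed.

(** The weight at the mode is at least the average of the k + l + 1 weights. This plays the part of
    Stirling's formula, at the cost of a polynomial factor. *)
Lemma bin_weight_ge k l : (k + l) ^ (k + l) <= (k + l).+1 * bin_weight k l k.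
Proof.
apply: (@leq_trans (\sum_(j < (k + l).+1) bin_weight k l k)); last first.
  by rewrite sum_nat_const card_ord.
by rewrite -sum_bin_weight; apply: leq_sum => j _; rewrite bin_weight_mode -1?ltnS.
Qed.

End BinomialWeights.

(** * Reduction of configurations to their number of up spins *)

Section ConfigurationCounts.
Context {R : realType}.
Implicit Types (n : nat).

Definition nup n (x : config n) : nat := #|finset (fun i => x i)|.

Lemma nup_le n (x : config n) : (nup x <= n)%N.
Proof. by rewrite -[leqRHS]card_ord max_card. Qed.

Lemma sum_spin n (x : config n) : \sum_(i < n) spin x i = 2 * (nup x)%:R - n%:R :> R.
Proof.
rewrite (eq_bigr (fun i => 2 * (x i)%:R - 1 : R)); last first.
  by move=> i _; rewrite /spin; case: (x i) => /=; ring.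
rewrite sumrB sumr_const card_ord -mulr_sumr; congr (2 * _ - _).
rewrite -natr_sum; congr (_%:R); rewrite /nup -sum1_card [RHS]big_mkcond/=.
by apply: eq_bigr => i _; rewrite inE; case: (x i).
Qed.

Lemma xbarE n (x : config n) : (0 < n)%N -> xbar x = (2 * (nup x)%:R - n%:R) / n%:R :> R.
Proof. by move=> n0; rewrite /xbar sum_spin mulrC. Qed.

Lemma hamiltonianE n (x : config n) : (0 < n)%N -> hamiltonian 2 x = n%:R * xbar x ^+ 2 :> R.
Proof.
move=> n0; rewrite /hamiltonian.
have -> : \sum_(i : {ffun 'I_2 -> 'I_n}) \prod_(j < 2) spin x (i j) =
    (\sum_(i < n) spin x i) ^+ 2 :> R.
  have := @bigA_distr_bigA R 0 1 *%R +%R 'I_2 'I_n (fun _ i => spin x i).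
  by move=> <-; rewrite prodr_const card_ord.
rewrite (_ : 1 - 2%:Z = -1)// exprN1 /xbar exprMn.
by field; rewrite pnatr_eq0 -lt0n.
Qed.

Lemma xbar_bound n (x : config n) : -1 <= (xbar x : R) <= 1.
Proof.
have [n0|n0] := posnP n.
  by rewrite /xbar (_ : n%:R = 0 :> R) ?n0// invr0 mul0r; lra.
have n0' : 0 < n%:R :> R by rewrite ltr0n.
rewrite xbarE// ler_pdivlMr// ler_pdivrMr//.
have := nup_le x; rewrite -(ler_nat R); have := ler0n R (nup x); lra.
Qed.

Definition set_of_config n (x : config n) : {set 'I_n} := finset (fun i => x i).
Definition config_of_set n (A : {set 'I_n}) : config n := [ffun i => i \in A].

Lemma set_of_configK n : cancel (@set_of_config n) (@config_of_set n).
Proof. by move=> x; apply/ffunP => i; rewrite ffunE inE. Qed.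

Lemma sum_config_nup n (F : nat -> R) :
  \sum_(x : config n) F (nup x) = \sum_(k < n.+1) 'C(n, k)%:R * F k.
Proof.
rewrite (partition_big (fun x : config n => inord (nup x) : 'I_n.+1) predT)//.
apply: eq_bigr => k _.
rewrite (eq_bigr (fun=> F k)); last first.
  by move=> x /andP[_ /eqP <-]; rewrite inordK// ltnS nup_le.
rewrite sumr_const [RHS]mulr_natl; congr (_ *+ _).
have := card_draws 'I_n k; rewrite card_ord => <-.
rewrite -(card_imset _ (can_inj (@set_of_configK n))); apply: eq_card => A.
rewrite [RHS]inE; apply/imsetP/eqP => [[x /eqnP xk ->]|Ak].
  by move: xk; rewrite /= inordK// ltnS nup_le.
exists (config_of_set A); last by apply/setP => i; rewrite inE ffunE.
apply/eqnP; rewrite /= inordK ?ltnS ?nup_le// -Ak.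
by apply: eq_card => i; rewrite inE ffunE.
Qed.

Lemma exists_nup n k : (k <= n)%N -> exists x : config n, nup x = k.
Proof.
move=> kn; have : (0 < #|[pred A : {set 'I_n} | #|A| == k]|)%N.
  by rewrite -cardsE card_draws card_ord bin_gt0.
case/card_gt0P => A; rewrite inE => /eqP Ak.
by exists (config_of_set A); rewrite -Ak; apply: eq_card => i; rewrite inE ffunE.
Qed.

Lemma expR_xlnx k (y : R) : 0 <= y -> ((k == 0%N) = (y == 0)) ->
  expR (k%:R * ln y) = y ^+ k.
Proof.
move=> y0 ky; have [k0|k0] := eqVneq k 0%N; first by rewrite k0 mul0r expR0.
by rewrite expRM_natl lnK// posrE lt0r y0 -ky k0.
Qed.

(* At [k = 0] and [k = n], [0 ^ 0 = 1] matches the convention [0 log 0 = 0]. *)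
Lemma expR_H_fun0 n k : (0 < n)%N -> (k <= n)%N ->
  expR (- (n%:R * H_fun 2 0 ((2 * k%:R - n%:R) / n%:R))) =
  2 ^+ n * (k%:R ^+ k * (n - k)%:R ^+ (n - k)) / n%:R ^+ n :> R.
Proof.
move=> n0 kn; have n0' : 0 < n%:R :> R by rewrite ltr0n.
have n00 : n%:R != 0 :> R by rewrite gt_eqF.
have -> : - (n%:R * H_fun 2 0 ((2 * k%:R - n%:R) / n%:R)) =
    k%:R * ln (2 * k%:R / n%:R) + (n - k)%:R * ln (2 * (n - k)%:R / n%:R) :> R.
  rewrite /H_fun natrB//.
  have -> : 1 + (2 * k%:R - n%:R) / n%:R = 2 * k%:R / n%:R :> R by field.
  have -> : 1 - (2 * k%:R - n%:R) / n%:R = 2 * (n%:R - k%:R) / n%:R :> R by field.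
  set u := ln _; set v := ln _; by field.
have H j : (j <= n)%N -> expR (j%:R * ln (2 * j%:R / n%:R)) = (2 * j%:R / n%:R) ^+ j :> R.
  move=> jn; rewrite expR_xlnx// ?divr_ge0 ?mulr_ge0//.
  by rewrite !mulf_eq0 !pnatr_eq0 invr_eq0 (negbTE n00) orbF.
rewrite expRD !H// ?leq_subr// !expr_div_n !exprMn.
rewrite -[in X in 2 ^+ X](subnKC kn) -[in X in _ / _ ^+ X](subnKC kn) !exprD.
by field; rewrite !expf_neq0.
Qed.

End ConfigurationCounts.

(** * Bounds on Gibbs probabilities at fixed sample size *)

Section GibbsMeasure.
Context {R : realType}.
Implicit Types (n p : nat) (b s : R).

Lemma pmfE p n b (x : config n) :
  Defs.pmf p b x = expR (b * hamiltonian p x) / \sum_(y : config n) expR (b * hamiltonian p y) :> R.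
Proof. by rewrite /Defs.pmf /partition_function mulVKf ?expf_neq0. Qed.

Lemma probE p n b (A : pred (config n)) :
  prob p b A = (\sum_(x | A x) expR (b * hamiltonian p x)) /
               \sum_(y : config n) expR (b * hamiltonian p y) :> R.
Proof. by rewrite /prob mulr_suml; apply: eq_bigr => x _; rewrite pmfE. Qed.

Lemma sum_expR_gt0 p n b : 0 < \sum_(y : config n) expR (b * hamiltonian p y) :> R.
Proof.
rewrite (bigD1 [ffun=> true])//= ltr_pwDl ?expR_gt0//.
by apply: sumr_ge0 => x _; rewrite expR_ge0.
Qed.

Lemma pmf_gt0 p n b (x : config n) : 0 < Defs.pmf p b x.
Proof. by rewrite pmfE divr_gt0 ?expR_gt0 ?sum_expR_gt0. Qed.

Lemma prob_ge0 p n b (A : pred (config n)) : 0 <= prob p b A.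
Proof. by apply: sumr_ge0 => x _; rewrite ltW ?pmf_gt0. Qed.

Lemma prob_predT p n b : prob p b (predT : pred (config n)) = 1 :> R.
Proof. by rewrite probE divff// gt_eqF ?sum_expR_gt0. Qed.

Lemma prob_predC p n b (A : pred (config n)) : prob p b (predC A) = 1 - prob p b A :> R.
Proof.
apply/eqP; rewrite eq_sym subr_eq eq_sym; apply/eqP.
by rewrite -(prob_predT p n b) addrC /prob [in RHS](bigID A).
Qed.

Lemma le_prob p n b (A B : pred (config n)) : {subset A <= B} -> prob p b A <= prob p b B.
Proof.
move=> AB; rewrite /prob [leRHS](bigID A)/=.
rewrite (eq_bigl A); last first.
  by move=> x; case: (boolP (A x)) => [/AB|]; rewrite ?andbT ?andbF// => ->.
by rewrite lerDl sumr_ge0// => x _; rewrite ltW ?pmf_gt0.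
Qed.

Lemma prob_predU p n b (A B : pred (config n)) :
  prob p b (predU A B) <= prob p b A + prob p b B.
Proof.
rewrite /prob big_mkcond [X in _ <= X + _]big_mkcond [X in _ <= _ + X]big_mkcond.
rewrite -big_split/=; apply: ler_sum => x _; have /ltW := pmf_gt0 p b x.
case: (A x) (B x) => [] []/=; lra.
Qed.

(** The second factor compensates the number of configurations with a given magnetization:
    multiplied by the binomial coefficient it is 2^n up to a factor n + 1. *)
Lemma hamiltonian_H_fun n b (x : config n) : (0 < n)%N ->
  expR (b * hamiltonian 2 x) =
  expR (n%:R * H_fun 2 b (xbar x)) * expR (- (n%:R * H_fun 2 0 (xbar x))).
Proof.
move=> n0; rewrite -expRD hamiltonianE//; congr expR.
by rewrite /H_fun; ring.
Qed.

(** The left side is 2^n times the probability of the mode [k] of a binomial law with parameters n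
    and k/n. That probability is at most 1, and at least 1/(n+1) in [class_weight_ge]. *)
Lemma class_weight_le n k : (0 < n)%N -> (k <= n)%N ->
  'C(n, k)%:R * expR (- (n%:R * H_fun 2 0 ((2 * k%:R - n%:R) / n%:R))) <= 2 ^+ n :> R.
Proof.
move=> n0 kn; rewrite expR_H_fun0//.
have n0' : 0 < n%:R ^+ n :> R by rewrite exprn_gt0// ltr0n.
rewrite [leLHS]mulrA ler_pdivrMr// mulrCA ler_pM2l ?exprn_gt0//.
have := bin_weight_le k (n - k); rewrite /bin_weight subnKC//.
by rewrite -(ler_nat R) !natrM !natrX.
Qed.

Lemma class_weight_ge n k : (0 < n)%N -> (k <= n)%N ->
  2 ^+ n <= n.+1%:R *
    ('C(n, k)%:R * expR (- (n%:R * H_fun 2 0 ((2 * k%:R - n%:R) / n%:R)))) :> R.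
Proof.
move=> n0 kn; rewrite expR_H_fun0//.
have n0' : 0 < n%:R ^+ n :> R by rewrite exprn_gt0// ltr0n.
rewrite [leRHS](_ : _ = 2 ^+ n * (n.+1%:R * ('C(n, k)%:R *
    (k%:R ^+ k * (n - k)%:R ^+ (n - k)))) / n%:R ^+ n); last by ring.
rewrite ler_pdivlMr// ler_pM2l ?exprn_gt0//.
have := bin_weight_ge k (n - k); rewrite /bin_weight subnKC//.
by rewrite -(ler_nat R) !natrM !natrX.
Qed.

(** There are n + 1 magnetization classes, each contributing at most 2^n exp(ns). *)
Lemma weight_le n b s (A : pred (config n)) : (0 < n)%N ->
  (forall x, A x -> H_fun 2 b (xbar x) <= s) ->
  \sum_(x | A x) expR (b * hamiltonian 2 x) <= n.+1%:R * 2 ^+ n * expR (n%:R * s).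
Proof.
move=> n0 As.
pose F k : R := expR (- (n%:R * H_fun 2 0 ((2 * k%:R - n%:R) / n%:R))).
apply: (@le_trans _ _ (\sum_(x : config n) expR (n%:R * s) * F (nup x))).
  rewrite big_mkcond/=; apply: ler_sum => x _; case: ifPn => [/As Hs|_].
    rewrite hamiltonian_H_fun// /F -xbarE// ler_pM2r ?expR_gt0// ler_expR.
    by rewrite ler_pM2l ?ltr0n.
  by rewrite mulr_ge0 ?expR_ge0.
rewrite -mulr_sumr mulrC ler_pM2r ?expR_gt0// sum_config_nup.
apply: (@le_trans _ _ (\sum_(k < n.+1) 2 ^+ n)).
  by apply: ler_sum => k _; apply: class_weight_le => //; rewrite -ltnS.
by rewrite sumr_const card_ord mulr_natl.
Qed.

Lemma weight_ge n b (A : pred (config n)) (x0 : config n) : (0 < n)%N ->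
  (forall x, nup x = nup x0 -> A x) ->
  2 ^+ n * expR (n%:R * H_fun 2 b (xbar x0)) <=
  n.+1%:R * \sum_(x | A x) expR (b * hamiltonian 2 x).
Proof.
move=> n0 Ax0.
(* Only the class of [x0] is kept from the sum. *)
pose F k : R := (k == nup x0)%:R *
  (expR (n%:R * H_fun 2 b ((2 * k%:R - n%:R) / n%:R)) *
   expR (- (n%:R * H_fun 2 0 ((2 * k%:R - n%:R) / n%:R)))).
apply: (@le_trans _ _ (n.+1%:R * \sum_(x : config n) F (nup x))); last first.
  rewrite ler_pM2l// [leRHS]big_mkcond/=; apply: ler_sum => x _.
  rewrite /F -xbarE// -hamiltonian_H_fun//.
  by case: eqP => [/Ax0 ->|_]; rewrite ?mul1r// mul0r; case: ifP => // _; rewrite expR_ge0.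
have kn : (nup x0 < n.+1)%N by rewrite ltnS nup_le.
rewrite sum_config_nup (bigD1 (Ordinal kn))//= big1 ?addr0; last first.
  by move=> k kx0; rewrite /F (_ : (k : nat) == nup x0 = false) ?mul0r ?mulr0//; apply: negbTE.
rewrite /F eqxx mul1r -xbarE//.
have := @class_weight_ge n (nup x0) n0 (nup_le x0); rewrite -xbarE//.
set G := expR (- _); set E := expR _ => HG.
rewrite [leRHS](_ : _ = E * (n.+1%:R * ('C(n, nup x0)%:R * G))); last by ring.
by rewrite mulrC ler_pM2l ?expR_gt0.
Qed.

(** One factor n + 1 counts the classes in the numerator; the other comes from bounding the
    partition sum below by the class of [x0], a free reference configuration. The powers of 2
    cancel. *)
Lemma prob_le n b s (A : pred (config n)) (x0 : config n) : (0 < n)%N ->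
  (forall x, A x -> H_fun 2 b (xbar x) <= s) ->
  prob 2 b A <= n.+1%:R ^+ 2 * expR (n%:R * (s - H_fun 2 b (xbar x0))).
Proof.
move=> n0 As; rewrite probE ler_pdivrMr ?sum_expR_gt0//.
apply: (le_trans (weight_le n0 As)).
have H := @weight_ge n b predT x0 n0 (fun _ _ => isT).
rewrite (mulrBr _ s) expRB; set E := expR (_ * s); set E0 := expR _ in H *.
set Z := \sum_(y | predT y) _ in H *; rewrite [leRHS](_ : _ = n.+1%:R * (E / E0 * (n.+1%:R * Z))).
  rewrite -[leLHS]mulrA ler_pM2l//.
  rewrite [leLHS](_ : _ = E / E0 * (2 ^+ n * E0)).
    by apply: ler_wpM2l H; rewrite divr_ge0 ?expR_ge0.
  by field; rewrite gt_eqF ?expR_gt0.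
by ring.
Qed.

Lemma prob_ge n b s (A : pred (config n)) (x0 : config n) : (0 < n)%N ->
  (forall x, nup x = nup x0 -> A x) ->
  (forall x : config n, H_fun 2 b (xbar x) <= s) ->
  expR (n%:R * (H_fun 2 b (xbar x0) - s)) <= n.+1%:R ^+ 2 * prob 2 b A.
Proof.
move=> n0 Ax0 Hs; rewrite probE mulrA ler_pdivlMr ?sum_expR_gt0//.
have H := @weight_le n b s predT n0 (fun x _ => Hs x).
apply: (le_trans (ler_wpM2l (expR_ge0 _) H)).
rewrite (mulrBr _ _ s) expRB expr2 -[leRHS]mulrA.
rewrite [leLHS](_ : _ = n.+1%:R * (2 ^+ n * expR (n%:R * H_fun 2 b (xbar x0)))).
  by rewrite ler_pM2l// weight_ge.
by field; rewrite gt_eqF ?expR_gt0.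
Qed.

End GibbsMeasure.

(** * Existence of the maximum likelihood estimator and its monotonicity in the Hamiltonian *)

Section MaximumLikelihood.
Context {R : realType}.
Implicit Types (n p : nat) (b r s t : R).

(** The reciprocal of the likelihood is a finite sum of exponentials in the parameter, easy to
    differentiate and to bound below by single terms. *)
Definition inv_pmf p n (x : config n) b : R :=
  \sum_(z : config n) expR (b * (hamiltonian p z - hamiltonian p x)).

Lemma pmf_inv p n (x : config n) b : Defs.pmf p b x = (inv_pmf p x b)^-1.
Proof.
rewrite pmfE -[LHS]invrK invfM invrK mulrC /inv_pmf; congr (_^-1).
by rewrite mulr_suml; apply: eq_bigr => z _; rewrite -expRN -expRD mulrBr.
Qed.

Lemma inv_pmf_gt0 p n (x : config n) b : 0 < inv_pmf p x b.
Proof. by rewrite -invr_gt0 -pmf_inv pmf_gt0. Qed.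

Lemma le_inv_pmf p n (x z : config n) b :
  expR (b * (hamiltonian p z - hamiltonian p x)) <= inv_pmf p x b.
Proof.
by rewrite /inv_pmf (bigD1 z)//= lerDl sumr_ge0// => y _; rewrite expR_ge0.
Qed.

Lemma pmf_ratio p n (x y : config n) b :
  Defs.pmf p b y = Defs.pmf p b x * expR (b * (hamiltonian p y - hamiltonian p x)).
Proof.
rewrite !pmfE mulrAC; congr (_ / _).
by rewrite -expRD mulrBr addrC subrK.
Qed.

Lemma pmf_le1 p n (x : config n) b : Defs.pmf p b x <= 1.
Proof.
rewrite pmf_inv invf_le1 ?inv_pmf_gt0//.
by apply: le_trans (le_inv_pmf p x x b); rewrite subrr mulr0 expR0.
Qed.

Lemma sup_likelihood_gt0 p n (x : config n) : 0 < sup_likelihood p x :> R.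
Proof.
apply: (lt_le_trans (pmf_gt0 p 0 x)); apply: ub_le_sup; last by exists 0.
by exists 1 => _ [r _ <-]; apply: pmf_le1.
Qed.

(** The term of [y] alone makes [inv_pmf] at [x] at least exp(r d) with d > 0. *)
Lemma pmf_cvgy0 p n (x y : config n) : hamiltonian p x < hamiltonian p y :> R ->
  Defs.pmf p r x @[r --> +oo] --> (0 : R).
Proof.
move=> xy; set d : R := hamiltonian p y - hamiltonian p x.
have d0 : 0 < d by rewrite subr_gt0.
apply: (@squeeze_cvgr _ _ _ _ (fun=> 0) (fun r => expR (- (r * d)))); last 2 first.
- exact: cvg_cst.
- apply: (@cvg_comp _ _ _ (fun r => r * d) (fun r => expR (- r))); last exact: cvgr_expR.
  by apply: gt0_cvgMly => //; exact: cvg_id.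
near=> r; rewrite (ltW (pmf_gt0 _ _ _))/= pmf_inv expRN.
by rewrite lef_pV2 ?posrE ?expR_gt0 ?inv_pmf_gt0//; exact: le_inv_pmf.
Unshelve. all: by end_near. Qed.

Lemma pmf_cvgNy0 p n (x y : config n) : hamiltonian p x < hamiltonian p y :> R ->
  Defs.pmf p r y @[r --> -oo] --> (0 : R).
Proof.
move=> xy; set d : R := hamiltonian p y - hamiltonian p x.
have d0 : 0 < d by rewrite subr_gt0.
apply/cvgNy_compNP.
apply: (@squeeze_cvgr _ _ _ _ (fun=> 0) (fun r => expR (- (r * d)))); last 2 first.
- exact: cvg_cst.
- apply: (@cvg_comp _ _ _ (fun r => r * d) (fun r => expR (- r))); last exact: cvgr_expR.
  by apply: gt0_cvgMly => //; exact: cvg_id.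
near=> r; rewrite (ltW (pmf_gt0 _ _ _))/= pmf_inv expRN.
rewrite lef_pV2 ?posrE ?expR_gt0 ?inv_pmf_gt0//.
by have := le_inv_pmf p y x (- r); rewrite mulNr -mulrN opprB.
Unshelve. all: by end_near. Qed.

Lemma is_derive_big_seq (T : Type) (u : seq T) (f : T -> R -> R) (df : T -> R) s :
  (forall z, is_derive s 1 (f z) (df z)) ->
  is_derive s 1 (fun t => \sum_(z <- u) f z t) (\sum_(z <- u) df z).
Proof.
move=> fE; elim: u => [|z u IH].
  under eq_fun do rewrite big_nil; rewrite big_nil; exact: is_derive_cst.
under eq_fun do rewrite big_cons; rewrite big_cons; exact: is_deriveD.
Qed.

Lemma is_derive_expRM s c : is_derive s 1 (fun t => expR (t * c)) (c * expR (s * c)).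
Proof.
have dM : is_derive s 1 (fun t : R => t * c) c.
  by apply: is_derive_eq; rewrite /GRing.scale/=; ring.
have := @is_derive1_comp _ _ (fun t : R => t * c) _ _ _ (is_derive_expR (s * c)) dM.
by rewrite mulrC.
Qed.

Lemma is_derive_inv_pmf p n (x : config n) s :
  is_derive s 1 (inv_pmf p x) (\sum_(z : config n)
    (hamiltonian p z - hamiltonian p x) * expR (s * (hamiltonian p z - hamiltonian p x))).
Proof. by apply: is_derive_big_seq => z; exact: is_derive_expRM. Qed.

(** The derivative of [inv_pmf] vanishes at its minimum: the expected Hamiltonian under [s] equals
    the observed one. *)
Lemma score_eq p n (x : config n) s : is_likelihood_max p x s ->
  \sum_(z : config n) hamiltonian p z * expR (s * hamiltonian p z) =
  hamiltonian p x * \sum_(z : config n) expR (s * hamiltonian p z).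
Proof.
move=> xs.
have D := is_derive_inv_pmf p x s.
have D0 : is_derive s 1 (inv_pmf p x) 0.
  apply: (@derive1_at_min _ _ (s - 1) (s + 1)); first by lra.
  - by move=> t _; have Dt := is_derive_inv_pmf p x t; exact: ex_derive.
  - by rewrite in_itv/=; lra.
  - move=> t _; have := xs t.
    by rewrite !pmf_inv lef_pV2 ?posrE ?inv_pmf_gt0.
have : \sum_(z : config n) (hamiltonian p z - hamiltonian p x) *
    expR (s * (hamiltonian p z - hamiltonian p x)) = 0.
  by rewrite -(@derive_val _ _ _ _ _ _ _ D) (@derive_val _ _ _ _ _ _ _ D0).
rewrite (eq_bigr (fun z => (expR (s * hamiltonian p x))^-1 *
  (hamiltonian p z * expR (s * hamiltonian p z) -
   hamiltonian p x * expR (s * hamiltonian p z)))); last first.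
  by move=> z _; rewrite mulrBr expRB; ring.
rewrite -mulr_sumr sumrB -mulr_sumr => /eqP.
by rewrite mulf_eq0 invr_eq0 expR_eq0/= subr_eq0 => /eqP.
Qed.

(* The likelihood ratio of [y] to [x] increases with the parameter, so the
   maximizers are ordered; a common one would satisfy two distinct score
   equations. *)
Lemma is_ML_lt p n (x y : config n) (r s : \bar R) :
  hamiltonian p x < hamiltonian p y :> R -> is_ML p x r -> is_ML p y s -> (r < s)%E.
Proof.
move=> xy; have d0 : 0 < hamiltonian p y - hamiltonian p x :> R by rewrite subr_gt0.
have Lx := sup_likelihood_gt0 p x; have Ly := sup_likelihood_gt0 p y.
(* The likelihood of [x] tends to 0 at +oo, and that of [y] at -oo, whereas both suprema are
   positive. *)
have nx : ~ is_ML p x (+oo%E : \bar R).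
  by move=> [_ L1]; have L0 := norm_cvg_unique (pmf_cvgy0 xy) L1; rewrite -L0 ltxx in Lx.
have ny : ~ is_ML p y (-oo%E : \bar R).
  by move=> [_ L1]; have L0 := norm_cvg_unique (pmf_cvgNy0 xy) L1; rewrite -L0 ltxx in Ly.
move=> xr ys; case: r xr => [r| |] xr; last 2 first.
- by case: (nx xr).
- by case: s ys => [s| |] ys; [exact: ltNyr|by []|case: (ny ys)].
case: s ys => [s| |] ys; [|exact: ltry|by case: (ny ys)].
rewrite lte_fin.
(* Optimality of [r] for [x] and of [s] for [y], chained through the likelihood ratio, gives
   [r <= s]; the score equations exclude equality. *)
have H1 := xr s; have H2 := ys r; move: H2.
rewrite !(pmf_ratio p x y) => H2.
rewrite lt_neqAle; apply/andP; split.
  apply/eqP => rs; rewrite -rs in ys.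
  have := score_eq xr; rewrite (score_eq ys) => /eqP; rewrite -subr_eq0 -mulrBl mulf_eq0.
  by rewrite (gt_eqF d0) (gt_eqF (sum_expR_gt0 _ _ _)).
have : Defs.pmf p s x * expR (r * (hamiltonian p y - hamiltonian p x)) <=
       Defs.pmf p s x * expR (s * (hamiltonian p y - hamiltonian p x)).
  by apply: le_trans H2; rewrite ler_pM2r ?expR_gt0.
by rewrite ler_pM2l ?pmf_gt0// ler_expR ler_pM2r.
Qed.

Lemma is_ML_hamiltonian p n (x y : config n) (r : \bar R) :
  hamiltonian p x = hamiltonian p y :> R -> is_ML p x r -> is_ML p y r.
Proof.
move=> xy; have E b : Defs.pmf p b y = Defs.pmf p b x.
  by rewrite (pmf_ratio p x y) xy subrr mulr0 expR0 mulr1.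
have EL : is_likelihood_max p y = is_likelihood_max p x :> (R -> Prop).
  by apply/funext => b; apply/propext; split=> H b'; have := H b'; rewrite !E.
have EF : (fun b => Defs.pmf p b y) = fun b => Defs.pmf p b x by apply/funext.
by case: r => [r| |]; rewrite /is_ML /sup_likelihood EL ?EF.
Qed.

(** The terms of [y] and [z] make [inv_pmf] coercive in both directions. Outside [-K, K] it is at
    least its value at 0, so a minimum over that interval is global. *)
Lemma exists_ML_interior p n (x y z : config n) :
  hamiltonian p y < hamiltonian p x :> R -> hamiltonian p x < hamiltonian p z :> R ->
  exists r, is_likelihood_max p x r.
Proof.
move=> yx xz; set C := inv_pmf p x 0; have C0 : 0 < C by apply: inv_pmf_gt0.
set K : R := Num.max (C / (hamiltonian p z - hamiltonian p x))
                     (C / (hamiltonian p x - hamiltonian p y)).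
have d1 : 0 < hamiltonian p z - hamiltonian p x :> R by rewrite subr_gt0.
have d2 : 0 < hamiltonian p x - hamiltonian p y :> R by rewrite subr_gt0.
have K0 : 0 < K by rewrite lt_max divr_gt0.
have far b : ~~ (- K <= b <= K) -> C <= inv_pmf p x b.
  rewrite negb_and -!ltNge => /orP[bK|Kb].
    apply: le_trans (le_inv_pmf p x y b); apply: le_trans (expR_ge1Dx _).
    have : C <= - b * (hamiltonian p x - hamiltonian p y).
      rewrite -ler_pdivrMr//; apply: (@le_trans _ _ K); first by rewrite le_max lexx orbT.
      lra.
    by lra.
  apply: le_trans (le_inv_pmf p x z b); apply: le_trans (expR_ge1Dx _).
  have : C <= b * (hamiltonian p z - hamiltonian p x).
    rewrite -ler_pdivrMr//; apply: (@le_trans _ _ K); first by rewrite le_max lexx.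
    lra.
  by lra.
have [||c cK cmin] := @EVT_min R (inv_pmf p x) (- K) K.
- by lra.
- apply: derivable_within_continuous => t _.
  by have Dt := is_derive_inv_pmf p x t; exact: ex_derive.
exists c => t; rewrite !pmf_inv lef_pV2 ?posrE ?inv_pmf_gt0//.
have [tK|/far] := boolP (- K <= t <= K); first by apply: cmin; rewrite in_itv.
by apply: le_trans; apply: cmin; rewrite in_itv/=; lra.
Qed.

(** All exponents in [inv_pmf] have nonpositive slope, and that of [y] a negative one. The
    likelihood is thus strictly increasing: no real maximizer exists and the supremum is the limit
    at +oo. *)
Lemma exists_ML_max p n (x y : config n) : hamiltonian p y < hamiltonian p x :> R ->
  (forall z : config n, hamiltonian p z <= hamiltonian p x :> R) -> is_ML p x (+oo%E : \bar R).
Proof.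
move=> yx xmax.
have ilt s t : s < t -> inv_pmf p x t < inv_pmf p x s.
  move=> st; rewrite /inv_pmf (bigD1 y)//= [ltRHS](bigD1 y)//= ltr_leD//.
    by rewrite ltr_expR ltr_nM2r// subr_lt0.
  by apply: ler_sum => z _; rewrite ler_expR ler_wnM2r ?subr_le0// ltW.
have plt s t : s < t -> Defs.pmf p s x < Defs.pmf p t x.
  by move=> st; rewrite !pmf_inv ltf_pV2 ?posrE ?inv_pmf_gt0// ilt.
split; first by move=> [r /(_ (r + 1))]; rewrite leNgt plt//; lra.
apply: nondecreasing_cvgr; last by exists 1 => _ [r _ <-]; apply: pmf_le1.
by move=> s t; rewrite le_eqVlt => /predU1P[->//|/plt/ltW].
Qed.

Lemma exists_ML_min p n (x y : config n) : hamiltonian p x < hamiltonian p y :> R ->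
  (forall z : config n, hamiltonian p x <= hamiltonian p z :> R) -> is_ML p x (-oo%E : \bar R).
Proof.
move=> xy xmin.
have ilt s t : s < t -> inv_pmf p x s < inv_pmf p x t.
  move=> st; rewrite /inv_pmf (bigD1 y)//= [ltRHS](bigD1 y)//= ltr_leD//.
    by rewrite ltr_expR ltr_pM2r// subr_gt0.
  by apply: ler_sum => z _; rewrite ler_expR ler_wpM2r ?subr_ge0// ltW.
have plt s t : s < t -> Defs.pmf p t x < Defs.pmf p s x.
  by move=> st; rewrite !pmf_inv ltf_pV2 ?posrE ?inv_pmf_gt0// ilt.
split; first by move=> [r /(_ (r - 1))]; rewrite leNgt plt//; lra.
apply/cvgNy_compNP.
have -> : sup_likelihood p x = sup (range (fun r => Defs.pmf p (- r) x)) :> R.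
  congr sup; apply/seteqP; split => _ [r _ <-]; exists (- r) => //.
  by rewrite opprK.
apply: nondecreasing_cvgr; last by exists 1 => _ [r _ <-]; apply: pmf_le1.
move=> s t; rewrite le_eqVlt => /predU1P[->//|st].
by apply/ltW/plt; rewrite ltrN2.
Qed.

Lemma exists_ML p n (x y z : config n) : hamiltonian p y < hamiltonian p z :> R ->
  exists r : \bar R, is_ML p x r.
Proof.
move=> yz.
have [/existsP[u xu]|xmax] := boolP [exists u : config n, hamiltonian p x < hamiltonian p u :> R].
  have [/existsP[v vx]|xmin] := boolP [exists v : config n, hamiltonian p v < hamiltonian p x :> R].
    by have [r rP] := exists_ML_interior vx xu; exists r%:E.
  exists -oo%E; apply: (exists_ML_min xu) => v; rewrite leNgt.
  by move: xmin; rewrite negb_exists => /forallP.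
have {}xmax (v : config n) : hamiltonian p v <= hamiltonian p x :> R.
  by rewrite leNgt; move: xmax; rewrite negb_exists => /forallP.
by exists +oo%E; apply: (@exists_ML_max _ _ x y) => //; apply: lt_le_trans yz _.
Qed.

(** The pair [u], [v] makes the Hamiltonian nonconstant, so that [get] returns a genuine maximizer.
    Equal Hamiltonians give equal sets of maximizers, hence the same choice. *)
Lemma le_beta_ML p n (x y u v : config n) : hamiltonian p u < hamiltonian p v :> R ->
  (beta_ML p x <= beta_ML p y :> \bar R)%E = (hamiltonian p x <= hamiltonian p y :> R).
Proof.
move=> uv.
have MLP (z : config n) : is_ML p z (beta_ML p z : \bar R).
  by have [r rP] := exists_ML z uv; apply: (getPex (ex_intro _ r rP)).
case: (ltgtP (hamiltonian p x : R) (hamiltonian p y)) => xy.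
- by rewrite ltW// (is_ML_lt xy).
- by apply/negbTE; rewrite -ltNge (is_ML_lt xy).
- have E : [set r : \bar R | is_ML p x r] = [set r | is_ML p y r].
    by apply/seteqP; split => r /= rP; [exact: is_ML_hamiltonian rP|exact: is_ML_hamiltonian rP].
  by rewrite /beta_ML E lexx.
Qed.

End MaximumLikelihood.

(** * Exponential rates for large samples and concentration of the absolute magnetization *)

Section LargeDeviations.
Context {R : realType}.
Implicit Types (n : nat) (b m s e u v : R).

Lemma near_sqr_le_expR e : 0 < e ->
  \forall n \near \oo, n.+1%:R ^+ 2 <= expR (n%:R * e) :> R.
Proof.
move=> e0; have e3 : 0 < e ^+ 3 by rewrite exprn_gt0.
near=> n.
have n1 : 1 <= n%:R :> R by near: n; exact: nbhs_infty_ger.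
(* The constant is 4 * 6: (n+1)^2 <= 4 n^2 is to be at most (ne)^3 / 3!, a term of the exponential
   series. *)
have n2 : 24 / e ^+ 3 <= n%:R by near: n; exact: nbhs_infty_ger.
move: n2; rewrite ler_pdivrMr// => n2.
have : (n%:R * e) ^+ 3 / 6 <= expR (n%:R * e).
  have /(@expR_ge1Dxn R _ 2) : 0 <= n%:R * e by rewrite mulr_ge0//; lra.
  by rewrite (_ : 3`! = 6)//; lra.
apply: le_trans; rewrite ler_pdivlMr// exprMn -natr1.
apply: (@le_trans _ _ (n%:R ^+ 2 * 24)).
  by rewrite !expr2; nra.
by rewrite [n%:R ^+ 3]exprSr -mulrA ler_pM2l// exprn_gt0//; lra.
Unshelve. all: by end_near. Qed.

Lemma near_xbar_between u v : -1 <= u -> u < v -> v <= 1 ->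
  \forall n \near \oo, exists x : config n, u < xbar x < v.
Proof.
move=> u1 uv v1; near=> n.
have n1 : 1 <= n%:R :> R by near: n; exact: nbhs_infty_ger.
have n2 : 3 / (v - u) <= n%:R by near: n; exact: nbhs_infty_ger.
move: n2; rewrite ler_pdivrMr ?subr_gt0// => n2.
have n0 : 0 < n%:R :> R by lra.
have n0' : (0 < n)%N by rewrite -(ltr_nat R).
(* A count of [t] up spins would give magnetization exactly [u]. The next integer overshoots by at
   most 2/n, less than v - u. *)
set t := n%:R * (1 + u) / 2; have t0 : 0 <= t by rewrite /t divr_ge0// mulr_ge0; lra.
have /andP[tl tr] := truncn_itv t0; set k := (Num.truncn t).+1 in tr.
have kE : k%:R = (Num.truncn t)%:R + 1 :> R by rewrite /k -natr1.
have kn : (k <= n)%N by rewrite -(ler_nat R) kE; rewrite /t in tl; nra.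
have [x xk] := exists_nup kn; exists x.
rewrite xbarE// xk ltr_pdivlMr// ltr_pdivrMr// kE; rewrite kE in tr.
by rewrite /t in tl tr; apply/andP; split; nra.
Unshelve. all: by end_near. Qed.

Lemma H_fun_near b m e : -1 < m < 1 -> 0 < e ->
  exists2 d, 0 < d & forall x, `|x - m| < d -> `|H_fun 2 b x - H_fun 2 b m| < e.
Proof.
move=> m1 e0; have Dm := is_derive_H_fun b m1.
have : {for m, continuous (H_fun 2 b)}.
  by apply/differentiable_continuous/derivable1_diffP/ex_derive.
move=> /cvgrPdist_lt/(_ _ e0)/nbhs_ballP[d /= d0 dP]; exists d => // x xd.
by rewrite distrC; apply: dP; rewrite /ball/= distrC.
Qed.

Lemma H_fun_max b m (x : R) : 0 < m < 1 -> artanh m = 2 * b * m -> 0 <= b ->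
  -1 <= x <= 1 -> H_fun 2 b x <= H_fun 2 b m.
Proof.
move=> m01 mE b0; rewrite -ler_norml -(H_fun_norm b x) => x1.
have := normr_ge0 x; set y := `|x| in x1 *; move=> y0.
case: (ltgtP y m) => [ym|my|->//].
  by apply/ltW/(H_fun_incr m01 mE).
by apply/ltW/(H_fun_decr_lt m01 mE).
Qed.

Section Supercritical.
Variables (b m : R).
Hypotheses (m01 : 0 < m < 1) (mE : artanh m = 2 * b * m) (b0 : 0 <= b).

(** The event is quantified after the threshold on n, since it will depend on the observed sample.
    Half of [e] absorbs the polynomial factor, the other half the distance of a reference
    magnetization from [m]. *)
Lemma near_prob_le s e : 0 < e ->
  \forall n \near \oo, forall A : pred (config n),
    (forall x, A x -> H_fun 2 b (xbar x) <= s) ->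
    prob 2 b A <= expR (n%:R * (s - H_fun 2 b m + e)).
Proof.
move=> e0; have m1 : -1 < m < 1 by case/andP: m01; lra.
have [d d0 dP] := @H_fun_near b m (e / 2) m1 (divr_gt0 e0 (ltr0Sn R 1)).
have H : \forall n \near \oo, exists x : config n, Num.max (-1) (m - d / 2) < xbar x < m.
  by apply: near_xbar_between; rewrite ?le_max ?lexx ?gt_max//; lra.
near=> n => A As.
have n0 : (0 < n)%N by near: n; exact: nbhs_infty_gt.
have [x] : exists x : config n, Num.max (-1) (m - d / 2) < xbar x < m by near: n.
rewrite gt_max => /andP[/andP[_ xl] xr].
apply: (le_trans (prob_le x n0 As)).
have : n.+1%:R ^+ 2 <= expR (n%:R * (e / 2)) by near: n; apply: near_sqr_le_expR; lra.
rewrite -(@ler_pM2r _ (expR (n%:R * (s - H_fun 2 b (xbar x)))))/= ?expR_gt0// => /le_trans; apply.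
rewrite -expRD ler_expR -mulrDr ler_pM2l ?ltr0n//.
have : `|H_fun 2 b (xbar x) - H_fun 2 b m| < e / 2.
  by apply: dP; rewrite ltr_norml; lra.
by rewrite ltr_norml; lra.
Unshelve. all: by end_near. Qed.

Lemma near_prob_ge u v s e : -1 <= u -> u < v -> v <= 1 -> 0 < e ->
  (forall z, u < z < v -> s <= H_fun 2 b z) ->
  \forall n \near \oo, forall A : pred (config n),
    (forall x : config n, u < xbar x < v -> A x) ->
    expR (n%:R * (s - H_fun 2 b m - e)) <= prob 2 b A.
Proof.
move=> u1 uv v1 e0 Hs; near=> n => A Auv.
have n0 : (0 < n)%N by near: n; exact: nbhs_infty_gt.
have [x xuv] : exists x : config n, u < xbar x < v.
  by near: n; apply: near_xbar_between.
have Ax y : nup y = nup x -> A y.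
  by move=> yx; apply: Auv; move: xuv; rewrite !xbarE// yx.
have HM (y : config n) : H_fun 2 b (xbar y) <= H_fun 2 b m.
  by apply: H_fun_max => //; apply: xbar_bound.
have := prob_ge n0 Ax HM; rewrite -ler_pdivrMl ?exprn_gt0//.
apply: le_trans; rewrite ler_pdivlMl ?exprn_gt0//.
have : n.+1%:R ^+ 2 <= expR (n%:R * e) by near: n; apply: near_sqr_le_expR.
rewrite -(@ler_pM2r _ (expR (n%:R * (s - H_fun 2 b m - e))))/= ?expR_gt0// => /le_trans; apply.
rewrite -expRD ler_expR -mulrDr ler_pM2l ?ltr0n//.
by have := Hs _ xuv; lra.
Unshelve. all: by end_near. Qed.

Lemma cvg_expR_Nlin e : 0 < e -> expR (n%:R * (- e)) @[n --> \oo] --> (0 : R).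
Proof.
move=> e0; under eq_fun do rewrite expRM_natl.
apply: cvg_expr; rewrite ger0_norm ?expR_ge0// expR_lt1; lra.
Qed.

Lemma prob_norm_xbar_far e : 0 < e ->
  prob 2 b (fun x : config n => e <= `| `|xbar x| - m|) @[n --> \oo] --> (0 : R).
Proof.
move=> e0; have /andP[m0 m1] := m01.
(* The largest rate at distance at least [e] from [m] is bounded by the values at m - e and m + e,
   clipped to [0, 1]. *)
set s := Num.max (H_fun 2 b (Num.max 0 (m - e))) (H_fun 2 b (Num.min 1 (m + e))).
have sM : s < H_fun 2 b m.
  rewrite gt_max; apply/andP; split.
    by apply: (H_fun_incr m01 mE); rewrite ?le_max ?lexx// gt_max m0/=; lra.
  apply: (H_fun_decr_lt m01 mE) => //; last by rewrite ge_min lexx.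
  by rewrite lt_min m1/=; lra.
have As n (x : config n) : e <= `| `|xbar x| - m| -> H_fun 2 b (xbar x) <= s.
  rewrite -(H_fun_norm b (xbar x)); have := @xbar_bound R n x; rewrite -ler_norml.
  move: (normr_ge0 (xbar x : R)); set y := `|xbar x| => y0 y1.
  rewrite ler_normr le_max => /orP[] ey; apply/orP; [right|left].
    apply: (@H_fun_decr _ b m) => //; first exact: ltW.
    - by move=> z mz; apply/ltW/(artanh_gt_root m01 mE).
    - by rewrite le_min (ltW m1)/=; lra.
    - by rewrite ge_min; apply/orP; right; lra.
  have [->|yn] := eqVneq y (Num.max 0 (m - e)); first by [].
  apply/ltW/(H_fun_incr m01 mE) => //; last by rewrite ge_max (ltW m0)/=; lra.
  by rewrite lt_neqAle yn le_max; apply/orP; right; lra.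
(* Half of the gap is spent as slack in [near_prob_le]; the other half remains as decay rate. *)
set h := (H_fun 2 b m - s) / 2.
have h0 : 0 < h by rewrite /h; lra.
apply: (@squeeze_cvgr _ _ _ _ (fun=> 0) (fun n => expR (n%:R * (- h)))); last 2 first.
- exact: cvg_cst.
- exact: cvg_expR_Nlin.
near=> n; rewrite prob_ge0/=.
have : forall A : pred (config n), (forall x, A x -> H_fun 2 b (xbar x) <= s) ->
    prob 2 b A <= expR (n%:R * (s - H_fun 2 b m + h)).
  by near: n; apply: near_prob_le.
move=> /(_ _ (As n)); rewrite (_ : s - H_fun 2 b m + h = - h)//.
by rewrite /h; field.
Unshelve. all: by end_near. Qed.

End Supercritical.
End LargeDeviations.

(** * Both estimators as increasing functions of the absolute magnetization, and their slope *)

Section BahadurSlopes.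
Context {R : realType}.
Implicit Types (n : nat) (b c l e : R).

(* As [0 / 0 = 0], the value at [0] agrees with the convention for
   [beta_MPL]. *)
Definition mpl_norm (t : R) : \bar R :=
  if t == 1 then +oo%E else (artanh t / (2 * t))%:E.

(** The quotient artanh t / t is even, and at t = -1 the product of -1/2 and -oo is again +oo. *)
Lemma beta_MPL_norm n (x : config n) : beta_MPL 2 x = mpl_norm `|xbar x|.
Proof.
rewrite /beta_MPL /mpl_norm; move: (xbar x : R) (@xbar_bound R n x) => t t1.
rewrite (_ : 1 - 2%:Z = -1)// exprN1.
have [->|t0] := eqVneq t 0.
  by rewrite normr0 (_ : 0 == 1 = false) ?mulr0 ?invr0 ?mulr0// eq_sym oner_eq0.
rewrite /atanhe; have [->|tn1] := eqVneq t 1.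
  by rewrite normr1 eqxx invr1 mulr1 gt0_muley// lte_fin invr_gt0.
have [->|tN1] := eqVneq t (-1).
  by rewrite normrN1 eqxx invrN1 mulrN1 lt0_muleNy// lte_fin oppr_lt0 invr_gt0//.
have tB : -1 < t < 1 by rewrite !lt_neqAle tn1 eq_sym tN1.
have -> : `|t| == 1 = false.
  by rewrite lt_eqF// ltr_norml.
rewrite -EFinM; congr EFin; rewrite ln_div ?posrE; [|lra..].
rewrite -/(artanh t) mulrC; case: ger0P => _; rewrite ?artanhN; field; exact: t0.
Qed.

Lemma mpl_norm_lt (s t : R) : 0 <= s -> s < t -> t <= 1 -> (mpl_norm s < mpl_norm t)%E.
Proof.
move=> s0 st t1; have s1 : s < 1 by lra.
rewrite /mpl_norm (lt_eqF s1).
have [_|tn1] := eqVneq t 1; first by rewrite ltry.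
have {tn1}t1 : t < 1 by rewrite lt_neqAle tn1.
rewrite lte_fin !invfM !mulrA mulrAC [ltRHS]mulrAC ltr_pM2r ?invr_gt0//.
move: s0; rewrite le_eqVlt => /predU1P[s0|s0]; last exact: artanh_div_lt.
have t0 : 0 < t by rewrite s0.
rewrite -s0 invr0 mulr0 divr_gt0//.
by rewrite (lt_le_trans t0)// artanh_ge_id// t1 ltW.
Qed.

Lemma le_beta_MPL n (x y : config n) :
  (beta_MPL 2 x <= beta_MPL 2 y :> \bar R)%E = (`|xbar x| <= `|xbar y| :> R).
Proof.
have B (z : config n) : `|xbar z| <= 1 :> R by rewrite ler_norml xbar_bound.
rewrite !beta_MPL_norm; case: (ltgtP `|xbar x : R| `|xbar y|) => [xy|yx|->].
- by rewrite ltW// mpl_norm_lt.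
- by apply/negbTE; rewrite -ltNge mpl_norm_lt.
- by rewrite lexx.
Qed.

Lemma le_hamiltonian n (x y : config n) : (0 < n)%N ->
  (hamiltonian 2 x <= hamiltonian 2 y :> R) = (`|xbar x| <= `|xbar y| :> R).
Proof.
move=> n0; rewrite !hamiltonianE// ler_pM2l ?ltr0n//.
rewrite -[in LHS](real_normK (num_real (xbar x))) -(real_normK (num_real (xbar y))).
by rewrite ler_sqr ?nnegrE.
Qed.

Lemma le_beta_ML2 n (x y : config n) : (1 < n)%N ->
  (beta_ML 2 x <= beta_ML 2 y :> \bar R)%E = (`|xbar x| <= `|xbar y| :> R).
Proof.
move=> n1; have n0 : (0 < n)%N by apply: ltnW.
(* One up spin against all up spins: for n >= 2 the absolute magnetizations |2 - n|/n and 1 differ,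
   so the Hamiltonian is not constant. *)
have [u uE] := exists_nup (ltnW n1); have [v vE] := exists_nup (leqnn n).
rewrite (@le_beta_ML _ _ _ _ _ u v) ?le_hamiltonian//.
have n1' : 1 < n%:R :> R by rewrite ltr1n.
rewrite ltNge le_hamiltonian// -ltNge !xbarE// uE vE.
rewrite [X in _ < `|X|](_ : _ = 1); last by field; rewrite gt_eqF//; lra.
rewrite normr1 ltr_norml ltr_pdivlMr ?ltr_pdivrMr; lra.
Qed.

Lemma le_test_stat (est : estimator) (b0 : R) n (x y : config n) : (0 < n)%N ->
  (test_stat est b0 x <= test_stat est b0 y)%E = (est n x <= est n y :> \bar R)%E.
Proof.
by move=> n0; rewrite /test_stat lee_pmul2l ?leeD2rE// ?lte_fin ?sqrtr_gt0 ?ltr0n.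
Qed.

(** The p-value depends on an estimator only through the order it induces on samples of a given
    size. *)
Lemma Lstat_norm (est : estimator) p (b0 : R) n (x : config n) : (0 < n)%N ->
  (forall y z : config n, (est n y <= est n z :> \bar R)%E = (`|xbar y| <= `|xbar z| :> R)) ->
  Lstat est p b0 x = prob p b0 (fun y : config n => `|xbar x| < `|xbar y| :> R).
Proof.
move=> n0 estE; rewrite /Lstat /test_cdf -prob_predC /prob; apply: eq_bigl => y /=.
by rewrite le_test_stat// estE -ltNge.
Qed.

Lemma cvg_in_prob_unique p b (Y : estimator) l l' :
  cvg_in_prob p b Y l -> cvg_in_prob p b Y l' -> l = l'.
Proof.
move=> Yl Yl'; apply/eqP; rewrite -subr_eq0; apply: contraT => ll'.
(* At this radius the two deviation events cover all configurations, infinite values of [Y]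
   included, so their probabilities cannot both tend to 0. *)
set d := `|l - l'| / 3; have e0 : 0 < d by rewrite divr_gt0 ?normr_gt0.
suff : 1 <= 0 :> R by rewrite ler10.
have S : prob p b (fun x : config n => (d%:E < `|Y n x - l%:E|)%E) +
    prob p b (fun x : config n => (d%:E < `|Y n x - l'%:E|)%E)
    @[n --> \oo] --> (0 : R).
  by rewrite -[X in _ --> X]addr0; apply: cvgD; [exact: Yl|exact: Yl'].
apply: (cvgr_to_ge S); near=> n; rewrite -(prob_predT p n b).
apply: le_trans (prob_predU _ _ _ _); apply: le_prob => x _.
rewrite unfold_in/=; apply: contraT; rewrite negb_or -!leNgt.
case: (Y n x) => [r| |]//=; rewrite !lee_fin => /andP[rl rl'].
have : `|l - l'| <= d + d.
  rewrite (_ : l - l' = (r - l') - (r - l)); last by ring.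
  by rewrite (le_trans (ler_normB _ _))// lerD.
have : 0 < `|l - l'| by rewrite normr_gt0.
by rewrite /d; lra.
Unshelve. all: by end_near. Qed.

Section Slope.
Variables (b0 b m0 m : R).
Hypotheses (hb0 : 0 <= b0) (hb : b0 < b).
Hypotheses (m001 : 0 < m0 < 1) (m0E : artanh m0 = 2 * b0 * m0).
Hypotheses (m01 : 0 < m < 1) (mE : artanh m = 2 * b * m).

(** Concentration is used under [b], where the sample lies near [m]; the tail of the p-value is
    estimated under [b0], whose rate function decreases beyond [m0 < m]. *)
Lemma is_bahadur_slope_norm (est : estimator) :
  (forall n (y z : config n), (1 < n)%N ->
    (est n y <= est n z :> \bar R)%E = (`|xbar y| <= `|xbar z| :> R)) ->
  is_bahadur_slope est 2 b0 b (2 * (H_fun 2 b0 m0 - H_fun 2 b0 m)).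
Proof.
move=> estE e e0; rewrite mulrA mulVf ?pnatr_eq0// mul1r opprB.
set l := H_fun 2 b0 m - H_fun 2 b0 m0.
have m0m : m0 < m := artanh_root_lt m001 m01 m0E mE hb.
have /andP[m00 m01'] := m001; have /andP[mgt0 mlt1] := m01.
have m1 : -1 < m < 1 by lra.
have e20 : 0 < e / 2 by lra.
have [d d0 dP] := H_fun_near b0 m1 e20.
(* The bounds on [t] keep (m + t, m + 2t) within distance [d] of [m], m - t at or beyond m0, and m +
   2t at most 1. *)
pose t := Num.min (d / 3) (Num.min (m - m0) ((1 - m) / 2)).
have [t0 td tm0 t1] : [/\ 0 < t, t <= d / 3, t <= m - m0 & t <= (1 - m) / 2].
  rewrite /t !lt_min !ge_min !lexx !orbT; split=> //.
  by apply/and3P; split; lra.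
apply: (@squeeze_cvgr _ _ _ _ (fun=> 0)
  (fun n => prob 2 b (fun x : config n => t <= `| `|xbar x| - m|))).
- near=> n; rewrite prob_ge0/=; apply: le_prob => x; rewrite !unfold_in/=.
  (* By contraposition: a sample within [t] of [m] has normalized log p-value within [e] of [l]. *)
  apply: contraTT; rewrite -ltNge -leNgt ltr_norml => /andP[xl xr].
  have n1 : (1 < n)%N by near: n; exact: nbhs_infty_gt.
  have n0 : (0 < n)%N := ltnW n1.
  have nR : 0 < n%:R :> R by rewrite ltr0n.
  rewrite Lstat_norm//; last by move=> y z; apply: estE.
  set L := prob _ _ _.
  (* A more extreme sample has absolute magnetization above m - t, where the rate under [b0] is at
     most its value at m - t. *)
  have Lle : L <= expR (n%:R * (H_fun 2 b0 (m - t) - H_fun 2 b0 m0 + e / 2)).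
    have : forall A : pred (config n),
        (forall x, A x -> H_fun 2 b0 (xbar x) <= H_fun 2 b0 (m - t)) ->
        prob 2 b0 A <= expR (n%:R * (H_fun 2 b0 (m - t) - H_fun 2 b0 m0 + e / 2)).
      by near: n; apply: near_prob_le.
    apply=> y xy; rewrite -(H_fun_norm b0 (xbar y)).
    apply: (@H_fun_decr _ b0 m0) => //; rewrite ?ler_norml ?xbar_bound//; [lra| |lra|lra].
    by move=> z mz; apply/ltW/(artanh_gt_root m001 m0E).
  (* Every magnetization in (m + t, m + 2t) is more extreme than the observed one. *)
  have leL : expR (n%:R * (H_fun 2 b0 m - e / 2 - H_fun 2 b0 m0 - e / 2)) <= L.
    have : forall A : pred (config n),
        (forall x : config n, m + t < xbar x < m + 2 * t -> A x) ->
        expR (n%:R * (H_fun 2 b0 m - e / 2 - H_fun 2 b0 m0 - e / 2)) <= prob 2 b0 A.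
      near: n; apply: near_prob_ge => //; [lra..|].
      move=> z zt; have : `|H_fun 2 b0 z - H_fun 2 b0 m| < e / 2.
        by apply: (dP); rewrite ltr_norml; lra.
      by rewrite ltr_norml; lra.
    by apply=> y xy; apply: lt_le_trans (ler_norm _); lra.
  (* Positivity of the p-value makes its extended logarithm finite. *)
  have L0 : 0 < L := lt_le_trans (expR_gt0 _) leL.
  rewrite (lt_geF L0) -EFinM -EFinD lee_fin ler_norml.
  rewrite mulrC lerBrDr lerBlDr ler_pdivlMr// ler_pdivrMr// ![_ * n%:R]mulrC.
  have Hmt : `|H_fun 2 b0 (m - t) - H_fun 2 b0 m| < e / 2.
    by apply: (dP); rewrite ltr_norml; lra.
  apply/andP; split.
    rewrite -[leLHS]expRK ler_ln ?posrE ?expR_gt0//; apply: le_trans leL.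
    by rewrite ler_expR ler_pM2l// /l; lra.
  rewrite -[leRHS]expRK ler_ln ?posrE ?expR_gt0//; apply: (le_trans Lle).
  by move: Hmt; rewrite ler_expR ler_pM2l// /l ltr_norml; lra.
- exact: cvg_cst.
- by apply: (prob_norm_xbar_far m01 mE) => //; rewrite ltW// (le_lt_trans hb0).
Unshelve. all: by end_near. Qed.

End Slope.

End BahadurSlopes.

Theorem theorem2 (R : realType) (b0 b delta : R)
    (hb0 : beta_star 2 < b0) (hb : b0 < b)
    (hdelta : 0 < delta < 1) :
  [/\ is_bahadur_slope (beta_MPL 2) 2 b0 b (bahadur_slope (beta_MPL 2) 2 b0 b),
      is_bahadur_slope (beta_ML 2) 2 b0 b (bahadur_slope (beta_ML 2) 2 b0 b),
      bahadur_slope (beta_MPL 2) 2 b0 b = bahadur_slope (beta_ML 2) 2 b0 b,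
      opt_sample_size (beta_MPL 2) 2 b0 b delta =
        opt_sample_size (beta_ML 2) 2 b0 b delta
    & bahadur_eff (beta_ML 2) (beta_MPL 2) 2 b0 b = 1].
Proof.
have b0_half : 2^-1 < b0 := le_lt_trans (@beta_star_ge_half R) hb0.
have b0_ge0 : 0 <= b0 by lra.
have [m0 m001 m0E] := exists_artanh_root b0_half.
have [m m01 mE] := exists_artanh_root (lt_trans b0_half hb).
set c := 2 * (H_fun 2 b0 m0 - H_fun 2 b0 m).
(* A nonzero slope is what makes the efficiency 1 and not the default 0 / 0 = 0. *)
have c_gt0 : 0 < c.
  rewrite mulr_gt0// subr_gt0; apply: (H_fun_decr_lt m001 m0E) => //.
    exact: artanh_root_lt m001 m01 m0E mE hb.
  by lra.
(* Existence makes the value chosen by [get] a slope, and uniqueness of limits in probability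
   identifies it with [c]. *)
have slope (est : estimator) : is_bahadur_slope est 2 b0 b c ->
    is_bahadur_slope est 2 b0 b (bahadur_slope est 2 b0 b) /\
    bahadur_slope est 2 b0 b = c.
  move=> estc; have est_get := getPex (ex_intro _ c estc); split => //.
  by have := cvg_in_prob_unique est_get estc; rewrite /bahadur_slope; lra.
have [MPL_slope MPLE] := slope _ (is_bahadur_slope_norm b0_ge0 hb m001 m0E m01 mE
  (fun n y z _ => le_beta_MPL y z)).
have [ML_slope MLE] := slope _ (is_bahadur_slope_norm b0_ge0 hb m001 m0E m01 mE
  (fun n y z n1 => le_beta_ML2 y z n1)).
split; [exact: MPL_slope|exact: ML_slope|by rewrite MPLE MLE| |].
  by rewrite /opt_sample_size MPLE MLE.
by rewrite /bahadur_eff MPLE MLE divff// gt_eqF.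
Qed.
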